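(* Let $\mathfrak A$ be a Hausdorff topological Abelian group, $\mu$ be an $\mathfrak A$-valued measure, and $\mathcal N$ be a completion ring for $\mu$. Then $\mathfrak C_{\mathcal N}\mu$ is an $\mathfrak A$-valued measure if and only if $\mathcal N$ is $\mu$-compatible.
   Context: $D_\mu$, $R_\mu$ denote the domain and range of a map $\mu$; all maps $\mu$ here have as domain a set of sets. Countable means finite or countably infinite. A ring (of sets) is a nonempty set of sets closed under union $A\cup B$ and difference $A\setminus B$; a $\delta$-ring ($\sigma$-ring) is a ring closed under intersections (resp. unions) of nonempty countable families. $\sigma(\mathcal K)$ is the smallest $\sigma$-ring containing the set of sets $\mathcal K$. For a set of sets $\mathcal K$, $\hat{\mathcal K}=\{A: A\subset B\text{ for some }B\in\mathcal K\}$. $A\Delta B=(A\setminus B)\cup(B\setminus A)$. A partition of a set $A$ is a family of pairwise disjoint (possibly empty) sets, indexed by a set $I$, whose union is $A$; it is countable if $I$ is countable. A family $f\colon I\to\mathfrak A$ is summable if the net $J\mapsto\sum_{i\in J}f(i)$ over finite subsets $J\subset I$ converges in $\mathfrak A$; the limit is $\sum_{i\in I}f(i)$. An $\mathfrak A$-valued measure is a map $\mu$ such that $D_\mu$ is a $\delta$-ring, $R_\mu\subset\mathfrak A$, and for every $A\in D_\mu$ and every countable partition $\mathbf A\colon I\to D_\mu$ of $A$ the family $\mu\circ\mathbf A$ is summable with $\mu(A)=\sum_{i\in I}\mu(\mathbf A(i))$. For a map $\mu$ with $\varnothing\in D_\mu$, a set $N\in D_\mu$ is $\mu$-null if $\mu(N')=\mu(\varnothing)$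 for every $N'\in D_\mu$ with $N'\subset N$; $\mathcal N_\mu$ is the set of all $\mu$-null sets. The map $\mu$ admits completion if $D_\mu$ is a ring and $\mu(B_1)=\mu(B_2)$ for all $B_1,B_2\in D_\mu$ with $B_1\Delta B_2\in\mathcal N_\mu$ (every group-valued content, hence every measure, admits completion). If $\mu$ admits completion, a completion ring for $\mu$ is a ring $\mathcal N$ such that $N\cap B\in\mathcal N$ for all $N\in\mathcal N$, $B\in D_\mu$, and $\mathcal N\cap D_\mu=\mathcal N_\mu$. For sets of sets $\mathcal Q,\mathcal N$, $\Delta(\mathcal Q,\mathcal N)=\{A: A\Delta B\in\mathcal N\text{ for some }B\in\mathcal Q\}$. The $\mathcal N$-completion $\mathfrak C_{\mathcal N}\mu$ is the unique (well-defined) map $\nu$ with $D_\nu=\Delta(D_\mu,\mathcal N)$ and $\nu(A)=\mu(B)$ whenever $A\in D_\nu$, $B\in D_\mu$, $A\Delta B\in\mathcal N$. A set of sets $\mathcal N$ is $\mu$-compatible if it is a $\delta$-ring and $\sigma(\mathcal N)\cap\hat D_\mu\subset\mathcal N$. *)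

(* Defs.v *)
From HB Require Import structures.
From mathcomp Require Import all_boot all_order all_algebra finmap.
From mathcomp Require Import summability.
From mathcomp Require Import all_classical all_reals all_analysis.

Set Implicit Arguments.
Unset Strict Implicit.
Unset Printing Implicit Defensive.

Import Order.TTheory GRing.Theory Num.Theory.

Local Open Scope classical_set_scope.
Local Open Scope ring_scope.

(* A map whose domain is a set of subsets of [T]; the values outside [sdom]
   are junk and every definition below ignores them. *)
Record set_map (T U : Type) := SetMap {
  sdom : set (set T);
  sfun :> set T -> U }.

Section set_systems.
Context {T : Type}.
Implicit Types (G K Q N : set (set T)).

(* A nonempty countable family is a sequence, possibly with repetitions, as in
   the library's [sigma_ring]. *)
Definition delta_ring G :=
  setring G /\
  (forall A : nat -> set T, (forall n, G (A n)) -> G (\bigcap_n A n)).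

Definition hereditary_closure K : set (set T) :=
  [set A | exists2 B, K B & A `<=` B].

Definition Delta Q N : set (set T) := [set A | exists2 B, Q B & N (A `+` B)].

End set_systems.

(* [partial_sum f @ totally] is the net of the sums of [f] over the finite
   subsets of its index type, directed by inclusion. *)
Definition is_measure (T : Type) (G : topologicalZmodType) (mu : set_map T G) :=
  delta_ring (sdom mu) /\
  forall (A : set T) (I : countType) (F : I -> set T),
    sdom mu A -> (forall i, sdom mu (F i)) ->
    trivIset setT F -> \bigcup_i F i = A ->
    partial_sum (mu \o F) @ totally --> mu A.

Section completion.
Context {T U : Type}.
Implicit Types (mu : set_map T U) (N : set (set T)).

Definition null_sets mu : set (set T) :=
  [set A | sdom mu A /\
           forall A', sdom mu A' -> A' `<=` A -> mu A' = mu set0].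

Definition admits_completion mu :=
  setring (sdom mu) /\
  forall B1 B2, sdom mu B1 -> sdom mu B2 -> null_sets mu (B1 `+` B2) ->
    mu B1 = mu B2.

Definition completion_ring mu N :=
  [/\ setring N,
      (forall M B, N M -> sdom mu B -> N (M `&` B)) &
      N `&` sdom mu = null_sets mu].

(* The value at [A] is read off an arbitrarily chosen [B] in the domain of [mu]
   with [A `+` B] in [N]; [completionE] shows that the choice is immaterial. *)
Definition completion mu N : set_map T U :=
  SetMap (Delta (sdom mu) N)
    (fun A => mu (xget set0 [set B | sdom mu B /\ N (A `+` B)])).

Definition compatible mu N :=
  delta_ring N /\ <<sr N >> `&` hereditary_closure (sdom mu) `<=` N.

Lemma completionE mu N : admits_completion mu -> completion_ring mu N ->
  forall A B, sdom mu B -> N (A `+` B) -> completion mu N A = mu B.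
Proof.
move=> [[D0 DU DD] adm] [[N0 NU ND] NI NE] A B DB NAB /=.
case: xgetP => [C _ [DC NAC]|/(_ B)]; last by move=> /(_ (conj DB NAB)).
apply: adm => //; rewrite -NE; split; last by apply: DU; exact: DD.
have -> : C `+` B = ((A `+` C) `|` (A `+` B)) `&` (C `+` B).
  apply/seteqP; split => [x|x []//] CB; split => //; move: CB.
  by rewrite /setY/=; have [] := pselect (A x); tauto.
by apply: NI; [exact: NU|apply: DU; exact: DD].
Qed.

End completion.

Section measure_admits_completion.
Context {T : Type} {G : topologicalZmodType} (hG : hausdorff_space G)
  (mu : set_map T G) (mmu : is_measure mu).

Let measure_fin (I : finType) (F : I -> set T) :
  (forall i, sdom mu (F i)) -> sdom mu (\bigcup_i F i) -> trivIset setT F ->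
  mu (\bigcup_i F i) = \sum_i mu (F i).
Proof.
move=> DF DUF tF; have cF := mmu.2 _ I F DUF DF tF erefl.
have FF : ProperFilter (@totally I) := totally_filter.
apply: (cvg_unique hG cF); apply: cvg_near_cst.
exists [fset i | i in I]%fset => //= J /fsubsetP IJ.
rewrite /partial_sum -(big_seq_fsetE _ _ predT (mu \o F))/=.
rewrite -[RHS]big_enum/=.
apply/perm_big/uniq_perm; rewrite ?fset_uniq ?enum_uniq// => i.
by rewrite mem_enum IJ//; apply/imfsetP; exists i.
Qed.

Lemma measure_set0 : mu set0 = 0.
Proof.
have [[[D0 _ _] _] _] := mmu.
have UE : \bigcup_(i in [set: void]) (fun=> set0 : set T) i = set0.
  by apply/seteqP; split => x // -[].
have := @measure_fin void (fun=> set0); rewrite UE => -> //.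
by rewrite big_pred0//; case.
Qed.

Lemma measureU2 A B : sdom mu A -> sdom mu B -> A `&` B = set0 ->
  mu (A `|` B) = mu A + mu B.
Proof.
move=> DA DB AB; have [[[_ DU _] _] _] := mmu.
pose F b := if b then A else B.
have UE : \bigcup_b F b = A `|` B.
  apply/seteqP; split => [x [[] _ ?]|x [?|?]]; [by left|by right| |].
    by exists true.
  by exists false.
have := @measure_fin bool F; rewrite UE big_bool; apply.
- by case.
- exact: DU.
- by apply/trivIsetP => -[] [] // _ _ _; rewrite // /F setIC.
Qed.

Lemma measure_admits_completion : admits_completion mu.
Proof.
have [[[D0 DU DD] _] _] := mmu; split=> // B1 B2 D1 D2 [_ nB].
have DI : sdom mu (B1 `&` B2) by rewrite -setDD; apply: (DD) => //; exact: DD.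
have nD C1 C2 : sdom mu C1 -> sdom mu C2 -> C1 `\` C2 `<=` B1 `+` B2 ->
    sdom mu (C1 `&` C2) -> mu C1 = mu (C1 `&` C2).
  move=> DC1 DC2 CB DC; rewrite -[in LHS](setUIDK C1 C2) measureU2//.
  - by rewrite (nB _ _ CB) ?measure_set0 ?addr0//; exact: DD.
  - exact: DD.
  - by apply/seteqP; split => x // [[_ ?] []].
rewrite (nD B1 B2)//; last by move=> x; left.
by rewrite [RHS](nD B2 B1) 1?setIC// => x; right.
Qed.

End measure_admits_completion.

(* Main.v *)
Require Import Defs.
From mathcomp Require Import all_boot all_order all_algebra.
From mathcomp Require Import all_classical all_reals all_analysis.
From mathcomp Require Import summability.

(** Write [D] for the domain of [mu]. The ring [N] is an ideal of the ring of
    sets [Delta D N]: for [M] in [N] and [A `+` B] in [N] with [B] in [D],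
    [M `&` A] is the symmetric difference of [M `&` B] and [M `&` (A `+` B)].
    So [Delta D N] consists of the sets that agree with some member of [D]
    modulo [N], and the question is how this congruence behaves under countable
    operations.

    If the completion is a measure, then [N] is exactly its set of null sets
    ([null_sets_completion]). Null sets of a measure form a delta-ring, being
    closed under passage to subsets in the domain, and a union of countably
    many of them is null as soon as it lies in the domain ([null_bigcup]). For
    [C] in [D] and [F n] in [N], the union of the [F n `&` C] is bounded by
    [C], hence lies in the domain, which is a delta-ring. Therefore the sets
    whose trace on every member of [D] is in [N] form a sigma-ring containing
    [N], hence containing [<<sr N >>], and a member of [<<sr N >>] bounded by a
    member of [D] equals its trace on it.

    Conversely, compatibility says that a countable union of members of [N] is
    negligible if it is bounded by a member of [D]. As every set in
    [Delta D N] is bounded by a member of [D] up to a member of [N], a set in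
    [Delta D N] covered by countably many members of [N] is itself in [N]
    ([ideal_cover]). This makes countable constructions on representatives
    legitimate: [Delta D N] is a delta-ring ([Delta_delta_ring]), and a
    countable partition in [Delta D N] agrees modulo [N], block by block and in
    its union, with a partition in [D] ([Delta_partition]). Countable
    additivity of the completion is then that of [mu] on the latter. *)

Set Implicit Arguments.
Unset Strict Implicit.
Unset Printing Implicit Defensive.

Local Open Scope classical_set_scope.

(** * Rings and delta-rings of sets *)

(** [tauto] is intuitionistic, so excluded middle is first applied to every
    atom [A x]. *)
Ltac set_tauto := let x := fresh "x" in
  apply/seteqP; split; intro x; rewrite /setY/=;
  repeat match goal with |- context [?A x] =>
    lazymatch goal with
    | _ : A x |- _ => fail
    | _ : ~ A x |- _ => fail
    | _ => destruct (pselect (A x))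
    end end; tauto.

Section rings.
Context {T : Type}.
Implicit Types (R : set (set T)) (A B X : set T).

Lemma setring_setI R A B : setring R -> R A -> R B -> R (A `&` B).
Proof.
by move=> [_ _ RD] RA RB; rewrite -setDD; apply: (RD) => //; exact: RD.
Qed.

Lemma setring_setY R A B : setring R -> R A -> R B -> R (A `+` B).
Proof. by move=> [_ RU RD] RA RB; apply: RU; exact: RD. Qed.

(** The empty set fills the positions of the sequence that encode no index,
    which also covers finite and empty families. *)
Lemma bigcup_countType (I : countType) (F : I -> set T) :
  \bigcup_i F i = \bigcup_n (if unpickle n is Some i then F i else set0).
Proof.
apply/seteqP; split => x [i _ Fx]; first by exists (pickle i); rewrite ?pickleK.
by case: (unpickle i) Fx => // j Fx; exists j.
Qed.

Lemma delta_ring_setD_bigcup R (I : countType) (F : I -> set T) B :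
  delta_ring R -> R B -> (forall i, R (F i)) -> R (B `\` \bigcup_i F i).
Proof.
move=> [[R0 _ RD] RI] RB RF; rewrite bigcup_countType setDE setC_bigcup.
rewrite -bigcapIr; last by exists 0%N.
by apply: RI => n; rewrite -setDE; apply: RD => //; case: unpickle.
Qed.

Lemma delta_ring_setI_bigcup R (I : countType) (F : I -> set T) B :
  delta_ring R -> R B -> (forall i, R (F i)) -> R (B `&` \bigcup_i F i).
Proof.
move=> dR RB RF; rewrite -setDD; have [[_ _ RD] _] := dR.
by apply: RD => //; exact: delta_ring_setD_bigcup.
Qed.

Lemma sigma_ring_bigcup R (I : countType) (F : I -> set T) :
  sigma_ring R -> (forall i, R (F i)) -> R (\bigcup_i F i).
Proof.
move=> [R0 _ RU] RF; rewrite bigcup_countType.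
by apply: RU => n; case: unpickle.
Qed.

End rings.

(** * Rings modulo an ideal *)

Section ideal.
Context {T : Type} (D N : set (set T)).
Hypotheses (ringD : setring D) (ringN : setring N).
Hypothesis (idealN : forall M B, N M -> D B -> N (M `&` B)).
Implicit Types (A B M X : set T).

Lemma sub_Delta A : D A -> Delta D N A.
Proof. by move=> DA; exists A => //; rewrite setYK; case: ringN. Qed.

Lemma ideal_sub_Delta M : N M -> Delta D N M.
Proof. by move=> NM; exists set0; rewrite ?setY0//; case: ringD. Qed.

Lemma Delta_choice (I : Type) (F : I -> set T) :
  (forall i, Delta D N (F i)) ->
  exists2 B : I -> set T, forall i, D (B i) & forall i, N (F i `+` B i).
Proof.
move=> dF; have /choice[B HB] : forall i, exists B, D B /\ N (F i `+` B).
  by move=> i; have [B DB NB] := dF i; exists B.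
by exists B => i; case: (HB i).
Qed.

(** [A] is the symmetric difference of [B] in [D] and of [A `+` B] in [N];
    intersection distributes over it, and both parts stay in [N]. *)
Lemma ideal_setI M A : N M -> Delta D N A -> N (M `&` A).
Proof.
move=> NM [B DB NAB].
have -> : M `&` A = (M `&` B) `+` (M `&` (A `+` B)) by set_tauto.
apply: setring_setY => //; first exact: idealN.
exact: setring_setI.
Qed.

Lemma ideal_setD M A : N M -> Delta D N A -> N (M `\` A).
Proof.
move=> NM DA; have [_ _ ND] := ringN.
have -> : M `\` A = M `\` (M `&` A) by set_tauto.
by apply: ND => //; exact: ideal_setI.
Qed.

Lemma ideal_subset M A : N M -> Delta D N A -> A `<=` M -> N A.
Proof. by move=> NM DA /setIidPr <-; exact: ideal_setI. Qed.

(** Congruence modulo the ideal is compatible with union and difference, by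
    telescoping the two arguments one at a time. *)
Lemma Delta_setring : setring (Delta D N).
Proof.
have [D0 DU DD] := ringD; split; first exact: sub_Delta.
- move=> A1 A2 dA1 dA2; have [B1 DB1 N1] := dA1; have [B2 DB2 N2] := dA2.
  exists (B1 `|` B2); first exact: DU.
  have -> : (A1 `|` A2) `+` (B1 `|` B2) =
      ((A1 `+` B1) `\` A2) `+` ((A2 `+` B2) `\` B1) by set_tauto.
  by apply: setring_setY => //; apply: ideal_setD => //; exact: sub_Delta.
- move=> A1 A2 dA1 dA2; have [B1 DB1 N1] := dA1; have [B2 DB2 N2] := dA2.
  exists (B1 `\` B2); first exact: DD.
  have -> : (A1 `\` A2) `+` (B1 `\` B2) =
      ((A1 `+` B1) `\` A2) `+` ((A2 `+` B2) `&` B1) by set_tauto.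
  apply: setring_setY => //; first exact: ideal_setD.
  exact: idealN.
Qed.

Section compatible.
Hypothesis (deltaD : delta_ring D) (deltaN : delta_ring N).
Hypothesis (compN : <<sr N >> `&` hereditary_closure D `<=` N).

(** This is how compatibility enters: a countable union of members of [N] lies
    in the generated sigma-ring, so it belongs to [N] once it is bounded by a
    member [C] of [D]; what sticks out of [C] has to be handled separately. *)
Lemma ideal_local_cover (I : countType) (M : I -> set T) X C :
  D C -> N (X `\` C) -> (forall i, N (X `&` M i)) ->
  X `<=` \bigcup_i M i -> N X.
Proof.
move=> DC NXC NXM XM; have [_ NU _] := ringN.
rewrite -(setUIDK X C); apply: NU => //; apply: compN; split; last by exists C.
have -> : X `&` C = \bigcup_i (X `&` M i `&` C).
  apply/seteqP; split => [x [Xx Cx]|x [i _ [[]]]//].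
  by have [i _ Mx] := XM _ Xx; exists i.
apply: sigma_ring_bigcup; first exact: smallest_sigma_ring.
by move=> i; apply: sub_g_sigma_ring; exact: idealN.
Qed.

(** A set congruent to [C] modulo [N] exceeds [C] by a member of [N] only. *)
Lemma ideal_cover (I : countType) (M : I -> set T) X :
  Delta D N X -> (forall i, N (M i)) -> X `<=` \bigcup_i M i -> N X.
Proof.
move=> dX NM XM; have [C DC NXC] := dX; have [_ _ rD] := Delta_setring.
apply: (ideal_local_cover DC _ _ XM) => [|i].
  apply: ideal_subset NXC _ _; last by move=> x; left.
  by apply: rD => //; exact: sub_Delta.
by rewrite setIC; exact: ideal_setI.
Qed.

(** If [A n] agrees with [B n] modulo [N], the difference of the two
    intersections is covered by the sets [A n `+` B n]. It is not yet known to
    lie in [Delta D N], so [ideal_cover] does not apply. Its traces on the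
    members of [N] are controlled by [N] being itself a delta-ring, and it
    exceeds [B 0] only inside [A 0 `+` B 0]. *)
Lemma Delta_delta_ring : delta_ring (Delta D N).
Proof.
have [_ DI] := deltaD; have [_ NI] := deltaN; have [_ _ ND] := ringN.
split; first exact: Delta_setring.
move=> A dA; have [B DB NM] := Delta_choice dA.
exists (\bigcap_n B n); first exact: DI.
set X := _ `+` _.
have XN M : N M -> N (X `&` M).
  move=> NM'.
  have -> : X `&` M = (\bigcap_n (A n `&` M)) `+` (M `&` \bigcap_n B n).
    rewrite bigcapIl; last by exists 0%N.
    by rewrite /X; set a := \bigcap_n A n; set b := \bigcap_n B n; set_tauto.
  apply: setring_setY => //; last by apply: idealN => //; exact: DI.
  by apply: NI => n; rewrite setIC; exact: ideal_setI.
apply: (@ideal_local_cover _ (fun n => A n `+` B n) _ (B 0%N)) => //.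
- have -> : X `\` B 0%N = (X `&` (A 0%N `+` B 0%N)) `\` B 0%N.
    apply/seteqP; split => [x [Xx nBx]|x [[]]//].
    split => //; split => //; left; split => //.
    by case: Xx => [[/(_ 0%N) + _]|[/(_ 0%N) /(_ I)/nBx]//]; exact.
  by apply: ideal_setD; [exact: XN|exact: sub_Delta].
- by move=> n; exact: XN.
- move=> x [[Ax]|[Bx]] /existsNP[n /not_implyP[_ nx]]; exists n => //.
    by left; split => //; exact: Ax.
  by right; split => //; exact: Bx.
Qed.

(** Choose representatives [B] of the union and [f i] of each [F i] in [D],
    and remove from each [B `&` f i] the overlaps of distinct [f i] and [f j].
    Off the countably many differences [F i `+` f i] and off the difference of
    the union with [B], a point lies in [f i] exactly when it lies in [F i], so
    there are no overlaps there and the sets obtained coincide with the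
    original ones. By [ideal_cover] they are congruent to them. Removing all
    overlaps, instead of the earlier sets only, requires no order on [I]. *)
Lemma Delta_partition (I : countType) (F : I -> set T) :
  Delta D N (\bigcup_i F i) -> (forall i, Delta D N (F i)) -> trivIset setT F ->
  exists g : I -> set T,
    [/\ forall i, D (g i), D (\bigcup_i g i), trivIset setT g,
        forall i, N (F i `+` g i) & N (\bigcup_i F i `+` \bigcup_i g i)].
Proof.
set A := \bigcup_i F i => dA dF tF; have [B DB NAB] := dA.
have [f Df Nf] := Delta_choice dF.
have [D0 _ DD] := ringD.
pose E2 (p : I * I) := if p.1 == p.2 then set0 else f p.1 `&` f p.2.
pose E := B `&` \bigcup_p E2 p.
have DE : D E.
  apply: delta_ring_setI_bigcup => // p; rewrite /E2; case: eqP => // _.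
  exact: setring_setI.
have EP x i j : B x -> f i x -> f j x -> ~ E x -> i = j.
  move=> Bx fi fj nE; apply: contrapT => /eqP ij; apply: nE; split => //.
  by exists (i, j) => //; rewrite /E2/= (negbTE ij).
pose g i := (B `&` f i) `\` E.
have Dg i : D (g i) by apply: DD => //; exact: setring_setI.
have gE : \bigcup_i g i = (B `&` \bigcup_i f i) `\` E.
  apply/seteqP; split => [x [i _ [[Bx fx] nE]]|x [[Bx [i _ fx]] nE]].
    by split => //; split => //; exists i.
  by exists i.
have DUg : D (\bigcup_i g i).
  by rewrite gE; apply: DD => //; exact: delta_ring_setI_bigcup.
pose M (o : option I) := if o is Some i then F i `+` f i else A `+` B.
have NM o : N (M o) by case: o.
(* off the exceptional sets, membership in the chosen representatives is
   membership in the original sets *)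
have MB x : ~ (\bigcup_o M o) x -> B x <-> A x.
  move=> nM; have : ~ (A `+` B) x by move=> ABx; apply: nM; exists None.
  by rewrite /setY/=; have [] := pselect (A x); have [] := pselect (B x); tauto.
have Mf x i : ~ (\bigcup_o M o) x -> f i x <-> F i x.
  move=> nM; have : ~ (F i `+` f i) x by move=> ?; apply: nM; exists (Some i).
  by rewrite /setY/=; have [] := pselect (F i x);
    have [] := pselect (f i x); tauto.
have ME x : ~ (\bigcup_o M o) x -> ~ E x.
  move=> nM [_ [[i j] _]]; rewrite /E2/=; case: eqP => // ij [].
  move=> /(Mf _ _ nM) Fi /(Mf _ _ nM) Fj; apply: ij.
  by apply: (tF i j) => //; exists x.
have Mg x i : ~ (\bigcup_o M o) x -> g i x <-> F i x.
  move=> nM; split => [[[_ /(Mf _ _ nM)]]//|Fx].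
  split; last exact: ME.
  by split; [apply/(MB _ nM); exists i|apply/(Mf _ _ nM)].
exists g; split => //.
- by move=> i j _ _ [x [[[Bx fi] nE] [[_ fj] _]]]; exact: (EP x).
- move=> i; apply: (ideal_cover (M := M)) => //.
    by apply: setring_setY => //; [exact: Delta_setring|exact: sub_Delta].
  move=> x Xx; apply: contrapT => nM; have := Mg _ i nM.
  by move: Xx; rewrite /setY/=; tauto.
- apply: (ideal_cover (M := M)) => //.
    by apply: setring_setY => //; [exact: Delta_setring|exact: sub_Delta].
  move=> x Xx; apply: contrapT => nM.
  case: Xx => -[[i _ ix]] nx; apply: nx; exists i => //.
    exact/(Mg _ _ nM).
  exact/(Mg _ _ nM).
Qed.

End compatible.
End ideal.

(** * The null sets of a measure *)

Section null_sets_measure.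
Context {T : Type} {G : topologicalZmodType} (hG : hausdorff_space G).
Context (nu : set_map T G) (mnu : is_measure nu).

(** A subset of the union is the disjoint union of its intersections with the
    successive differences of the sequence, each of measure zero; uniqueness of
    the limit in a Hausdorff group then makes its measure zero. *)
Lemma null_bigcup (F : nat -> set T) :
  (forall n, null_sets nu (F n)) -> sdom nu (\bigcup_n F n) ->
  null_sets nu (\bigcup_n F n).
Proof.
move=> nF dF; split => // A dA AF; rewrite (measure_set0 hG mnu).
have [[ringD _] add] := mnu; have [D0 DU DD] := ringD.
pose H n := A `&` seqDU F n.
have dH n : sdom nu (H n).
  apply: setring_setI => //; rewrite /seqDU; apply: DD; first by case: (nF n).
  by elim/big_ind: _ => // i _; case: (nF i).
have UH : \bigcup_n H n = A.
  rewrite /H -setI_bigcupr -seqDU_bigcup_eq; exact: setIidl.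
have tH : trivIset setT H by apply: trivIset_setIl; exact: trivIset_seqDU.
have H0 n : nu (H n) = 0%R.
  rewrite -(measure_set0 hG mnu); apply: (nF n).2 => //.
  by move=> x [_ []].
have := add A _ H dA dH tH UH.
have -> : partial_sum (nu \o H) = (fun=> 0%R : G).
  by apply/funext => J; rewrite /partial_sum big1// => i _ /=.
have FF := @totally_filter nat.
by move=> /(cvg_unique hG); apply; exact: cvg_cst.
Qed.

End null_sets_measure.

Section completion_null_sets.
Context {T U : Type} (mu : set_map T U) (N : set (set T)).
Hypotheses (adm : admits_completion mu) (hN : completion_ring mu N).

(** A null set [A] of the completion is congruent to some [B] in the domain of
    [mu], and [B] is [mu]-null: every [C] in that domain below [B] is congruent
    to [C `&` A], which is a subset of [A], so [mu C] is the value of the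
    completion there. *)
Lemma null_sets_completion : null_sets (completion mu N) = N.
Proof.
have [ringD _] := adm; have [ringN idealN NE] := hN.
have [D0 _ DD] := ringD; have [N0 NU _] := ringN.
have c0 : completion mu N set0 = mu set0 by apply: completionE; rewrite ?setYK.
apply/seteqP; split => [A [dA nA]|M NM]; last first.
  split; first exact: ideal_sub_Delta.
  move=> A dA AM; rewrite c0; apply: completionE => //.
  by rewrite setY0; exact: (ideal_subset ringN idealN NM).
have [B DB NAB] := dA.
suff NB : N B.
  have -> : A = (A `+` B) `+` B by set_tauto.
  exact: setring_setY.
suff : null_sets mu B by rewrite -NE => -[].
split => // C DC CB; rewrite -c0 -(nA (C `&` A)).
- apply/esym; apply: completionE => //.
  apply: (ideal_subset ringN idealN NAB) => //.
    apply: setring_setY; first exact: Delta_setring.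
      apply: setring_setI => //; first exact: Delta_setring.
      exact: sub_Delta.
    exact: sub_Delta.
  move=> x [[[]]|[Cx nCA]] //; right; split=> [|Ax]; first exact: CB.
  exact: nCA.
- apply: setring_setI => //; first exact: Delta_setring.
  exact: sub_Delta.
- exact: subIsetr.
Qed.

End completion_null_sets.

(** * Completions that are measures *)

Theorem theorem6p9 (T : Type) (G : topologicalZmodType) (hG : hausdorff_space G)
    (mu : set_map T G) (hmu : is_measure mu)
    (N : set (set T)) (hN : completion_ring mu N) :
  is_measure (completion mu N) <-> compatible mu N.
Proof.
have adm := measure_admits_completion hG hmu.
have [ringN idealN NE] := hN; have [deltaD addmu] := hmu.
have ringD := deltaD.1.
split => [mnu|[deltaN compN]].
- have Nnull := null_sets_completion adm hN.
  have [deltaDN _] := mnu; have [ringDN DNI] := deltaDN.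
  have [N0 _ ND] := ringN.
  have deltaN : delta_ring N.
    split => // A NA; apply: (ideal_subset ringN idealN (NA 0%N)) => //.
      by apply: DNI => n; exact: ideal_sub_Delta.
    exact: bigcap_inf.
  split => // A [sA [B DB AB]].
  (* the right-hand side is a sigma-ring, which [N] itself need not be *)
  suff : <<sr N >> `<=` [set X | forall C, sdom mu C -> N (X `&` C)].
    by move=> /(_ A sA B DB); rewrite (setIidl AB).
  apply: smallest_sub; last by move=> M NM C DC; exact: idealN.
  split => /=.
  + by move=> C _; rewrite set0I.
  + move=> X Y NX NY C DC.
    have -> : (X `\` Y) `&` C = (X `&` C) `\` (Y `&` C) by set_tauto.
    by apply: ND; [exact: NX|exact: NY].
  + move=> F NF C DC; rewrite setI_bigcupl -Nnull.
    apply: null_bigcup => //; first by move=> n; rewrite Nnull; exact: NF.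
    have -> : \bigcup_n (F n `&` C) = C `&` \bigcup_n (F n `&` C).
      by apply/esym/setIidr; rewrite -setI_bigcupl; exact: subIsetr.
    apply: delta_ring_setI_bigcup => //; first exact: sub_Delta.
    by move=> n; apply: ideal_sub_Delta => //; exact: NF.
- split; first exact: Delta_delta_ring.
  move=> A I F dA dF tF AE; rewrite -AE in dA *.
  have [B [DB DUB tB NFB NAB]] :=
    Delta_partition ringD ringN idealN deltaD compN dA dF tF.
  rewrite (completionE adm hN DUB NAB).
  have -> : completion mu N \o F = mu \o B.
    by apply/funext => i /=; exact: (completionE adm hN (DB i) (NFB i)).
  exact: addmu.
Qed.
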